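(* Let $f(X)\in\mathbb{Z}[X]$ be a polynomial of degree $n\geq 1$ with $f(0)\neq 0$, let $k\geq 2$, and let $p_{1},\dots ,p_{k}$ be pairwise distinct prime numbers. For $i=1,\dots ,k$ let $w_{i,1},\dots ,w_{i,n_{i}}$ denote the widths of all the segments of the Newton polygon of $f$ with respect to $p_{i}$ (listed with multiplicity, so they need not be distinct), and let $\mathcal{S}_{p_{i}}$ be the set of all integers in the interval $(0,\lfloor \frac{n}{2}\rfloor ]$ that may be written as a linear combination of $w_{i,1},\dots ,w_{i,n_{i}}$ with coefficients $0$ or $1$. If $\mathcal{S}_{p_{1}}\cap\cdots \cap\mathcal{S}_{p_{k}}=\emptyset$, then $f$ is irreducible over $\mathbb{Q}$.
   Context: For a prime $p$ and a nonzero integer $m$, $\nu_p(m)$ is the largest integer $i$ with $p^i\mid m$; $\nu_p(0)=\infty$. For $f(X)=\sum_{i=0}^n a_iX^i\in\mathbb{Z}[X]$ with $a_0a_n\neq 0$, the Newton polygon of $f$ with respect to $p$ is the lower convex hull of the points $(i,\nu_p(a_i))$, $0\le i\le n$, $a_i\neq 0$: a broken line from $(0,\nu_p(a_0))$ to $(n,\nu_p(a_n))$. Its vertices $A_0,\dots,A_m$ are the corner points (including the two end-points), and the edges are the pieces $A_jA_{j+1}$; the slopes of the edges strictly increase from left to right. All points with integer coordinates lying on the broken line subdivide it into segments: a segment is a piece of the broken line joining two consecutive points with integer coordinates on it (so a segment contains no points with integer coordinates other than its end-points, and each edge is composed of one or more segments). The width of a segment is the length of its projection onto the $x$-axis. 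*)

(* Defs.v *)
From HB Require Import structures.
From mathcomp Require Import all_boot all_order all_algebra.
From mathcomp Require Import boolp classical_sets reals convex.

Set Implicit Arguments.
Unset Strict Implicit.
Unset Printing Implicit Defensive.

Import Order.TTheory GRing.Theory Num.Theory.
Local Open Scope classical_set_scope.
Local Open Scope ring_scope.

(* Only meaningful for m != 0: [logn p 0] is 0 rather than infinity. *)
Definition padic_val (p : nat) (m : int) : nat := logn p `|m|%N.

(* R^o * R^o is the real plane, as an R-module. *)
Definition newton_points (R : realType) (p : nat) (f : {poly int}) :
    set (convex_lmodType (R^o * R^o)%type) :=
  [set P | exists i : nat, f`_i != 0 /\ P = (i%:R, (padic_val p f`_i)%:R)].
Arguments newton_points R p f : clear implicits.

Definition convex_hull (R : realType)
    (A : set (convex_lmodType (R^o * R^o)%type)) :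
    set (convex_lmodType (R^o * R^o)%type) :=
  smallest (@convex_set R (R^o * R^o)%type) A.

(* The broken line: the lower boundary of the convex hull. *)
Definition newton_polygon (R : realType) (p : nat) (f : {poly int}) :
    set (convex_lmodType (R^o * R^o)%type) :=
  [set P | convex_hull (newton_points R p f) P /\
     forall y : R, convex_hull (newton_points R p f) (P.1, y) -> P.2 <= y].
Arguments newton_polygon R p f : clear implicits.

(* The abscissas, in increasing order, of the points with integer coordinates
   on the broken line.  When f`_0 != 0 the broken line lies above the interval
   [0, deg f], with one point above each abscissa, so ranging over
   0, ..., (size f).-1 misses no such point. *)
Definition lattice_abscissas (R : realType) (p : nat) (f : {poly int}) :
    seq nat :=
  [seq x <- iota 0 (size f) |
     `[< exists y : int, newton_polygon R p f (x%:R, y%:~R) >]].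

(* The segments join consecutive points with integer coordinates; there are
   none when [lattice_abscissas] has fewer than two items. *)
Definition segment_widths (R : realType) (p : nat) (f : {poly int}) : seq nat :=
  let xs := lattice_abscissas R p f in
  [seq (t.2 - t.1)%N | t <- zip xs (behead xs)].

(* The boolean coefficient [c j] is coerced to 0 or 1. *)
Definition width_sums (R : realType) (p : nat) (f : {poly int}) : set nat :=
  let w := segment_widths R p f in
  [set d : nat | (0 < d <= (size f).-1./2)%N /\
     exists c : 'I_(size w) -> bool,
       d = (\sum_(j < size w) c j * nth 0 w j)%N].

(* Main.v *)
Require Import Defs.
From HB Require Import structures.
From mathcomp Require Import all_boot all_order all_algebra.
From mathcomp Require Import boolp classical_sets reals convex.
From mathcomp Require Import zify ring lra interval_inference.

Set Implicit Arguments.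
Unset Strict Implicit.
Unset Printing Implicit Defensive.

Import Order.TTheory GRing.Theory Num.Theory.
Local Open Scope classical_set_scope.
Local Open Scope ring_scope.

(* Fix a prime and write f = g h over Z.  By Gauss' lemma for the valuation
   "min_i (v(a_i) - s i)", the left (right) end of the edge of slope s of the
   Newton polygon of f is the sum of those of g and h.  Hence (Dumas) the polygon
   of f is obtained by sorting the segments of g and h by slope, and segments of
   equal slope have equal width, so deg g is the sum of some of the widths of the
   segments of f.  If f is a proper product then the smaller of the degrees of the
   two factors thus lies in every set of width sums. *)

(** * Valuations of products and sums of integers *)

Lemma coef_neq0_lt_size (f : {poly int}) i : f`_i != 0 -> (i < size f)%N.
Proof. by rewrite ltnNge; apply: contra => le_i; rewrite nth_default. Qed.

Lemma padic_val_dvdz (p : nat) (m : nat) (x : int) :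
  prime p -> x != 0 -> ((p ^ m)%N %| x)%Z = (m <= padic_val p x)%N.
Proof. by move=> pp x0; rewrite dvdzE pfactor_dvdn // absz_gt0. Qed.

Lemma padic_valM (p : nat) (x y : int) : x != 0 -> y != 0 ->
  padic_val p (x * y) = (padic_val p x + padic_val p y)%N.
Proof. by move=> x0 y0; rewrite /padic_val abszM lognM // absz_gt0. Qed.

(** Otherwise [p ^ m.+1] would divide every term, hence the sum. The term must be nonzero to be of
    use, as [padic_val p 0] is 0. *)
Lemma exists_padic_val_le (p n : nat) (F : 'I_n -> int) : prime p ->
  \sum_i F i != 0 ->
  exists2 i, F i != 0 & (padic_val p (F i) <= padic_val p (\sum_i F i))%N.
Proof.
move=> pp S0; set m := padic_val p _.
have: ~~ ((p ^ m.+1)%N %| (\sum_i F i))%Z by rewrite padic_val_dvdz // ltnn.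
move=> ndvd.
have /existsP[i Fi] : [exists i, ~~ ((p ^ m.+1)%N %| F i)%Z].
  apply: contraR ndvd; rewrite negb_exists => /forallP H.
  by apply: rpred_sum => i _; have := H i; rewrite negbK.
have Fi0 : F i != 0 by apply: contraNneq Fi => ->; rewrite dvdz0.
by exists i => //; move: Fi; rewrite padic_val_dvdz // -leqNgt.
Qed.

(** For [k <= m.+1], [p ^ k] divides the sum of the other terms, so it divides the whole sum iff it
    divides [F i0]. *)
Lemma padic_val_sum_dominant (p n : nat) (F : 'I_n -> int) (i0 : 'I_n) :
  prime p -> F i0 != 0 ->
  (forall i, i != i0 -> F i != 0 ->
     (padic_val p (F i0) < padic_val p (F i))%N) ->
  \sum_i F i != 0 /\ padic_val p (\sum_i F i) = padic_val p (F i0).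
Proof.
move=> pp F0 lt_F; set m := padic_val p (F i0).
have dvd_rest : ((p ^ m.+1)%N %| (\sum_(i | i != i0) F i))%Z.
  apply: rpred_sum => i ii0; have [->|Fi0] := eqVneq (F i) 0; first exact: dvdz0.
  by rewrite padic_val_dvdz // lt_F.
have dvdE (k : nat) : (k <= m.+1)%N ->
    ((p ^ k)%N %| (\sum_i F i))%Z = (k <= m)%N.
  move=> km; rewrite -(padic_val_dvdz _ pp F0) (bigD1 i0) //= rpredDr //.
  by apply: dvdz_trans dvd_rest; rewrite dvdzE /= dvdn_exp2l.
have S0 : \sum_i F i != 0.
  by apply/eqP => S0; have := dvdE m.+1 (leqnn _); rewrite S0 dvdz0 ltnn.
split=> //; apply/eqP; rewrite eqn_leq.
rewrite -padic_val_dvdz // dvdE // leqnn andbT leqNgt.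
by rewrite -padic_val_dvdz // dvdE // ltnn.
Qed.

(** * Supporting lines and Gauss' lemma *)

(* The ordinate at 0 of the line of slope s through the i-th Newton point of f;
   a junk value when f`_i = 0. *)
Definition height (R : realType) (p : nat) (f : {poly int}) (s : R) (i : nat) : R :=
  (padic_val p f`_i)%:R - s * i%:R.

(* The supporting line of slope s passes through the i-th Newton point of f. *)
Definition touches (R : realType) (p : nat) (f : {poly int}) (s : R) (i : nat) :=
  f`_i != 0 /\ forall j, f`_j != 0 -> height p f s i <= height p f s j.

Lemma touches_height_le (R : realType) p f (s : R) i j :
  touches p f s i -> f`_j != 0 -> height p f s j <= height p f s i ->
  touches p f s j.
Proof. by move=> [fi ti] fj le_ji; split=> // k fk; apply: le_trans le_ji (ti _ fk). Qed.

Lemma touches_height_eq (R : realType) p f (s : R) i j :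
  touches p f s i -> touches p f s j -> height p f s i = height p f s j.
Proof. by move=> [fi ti] [fj tj]; apply/eqP; rewrite eq_le ti // tj. Qed.

Lemma touches_height_lt (R : realType) p f (s : R) i j :
  touches p f s i -> f`_j != 0 -> ~ touches p f s j ->
  height p f s i < height p f s j.
Proof.
move=> ti fj ntj; rewrite ltNge; apply/negP => le_ji.
by apply/ntj/(touches_height_le ti).
Qed.

Lemma heightM (R : realType) p (g h : {poly int}) (s : R) i k : (i <= k)%N ->
  g`_i != 0 -> h`_(k - i) != 0 ->
  (padic_val p (g`_i * h`_(k - i)))%:R - s * k%:R =
  height p g s i + height p h s (k - i).
Proof.
move=> ik gi hj; rewrite padic_valM // natrD /height natrB //; ring.
Qed.

(** Some term of the convolution has valuation at most that of the sum, and its height is a height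
    of [g] plus a height of [h]. *)
Lemma height_mul_ge (R : realType) p (g h : {poly int}) (s : R) i j k :
  prime p -> touches p g s i -> touches p h s j -> (g * h)`_k != 0 ->
  height p g s i + height p h s j <= height p (g * h) s k.
Proof.
move=> pp [gi ti] [hj tj]; rewrite /height coefM => fk.
have [l] := exists_padic_val_le pp fk.
rewrite mulf_eq0 negb_or => /andP[gl hl] le_v.
have lk : (l <= k)%N by rewrite -ltnS.
apply: (@le_trans _ _ (height p g s l + height p h s (k - l))).
  by rewrite lerD ?ti ?tj.
by rewrite -heightM // lerD2r ler_nat.
Qed.

(* Gauss' lemma for the valuation attached to the slope s. *)
Lemma touches_mul (R : realType) p (g h : {poly int}) (s : R) i j :
  prime p -> touches p g s i -> touches p h s j ->
  (forall i' j', (i' + j' = i + j)%N -> touches p g s i' -> touches p h s j' ->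
    i' = i) ->
  touches p (g * h) s (i + j).
Proof.
move=> pp tg th uniq_ij; have [gi ti] := tg; have [hj tj] := th.
have lt_i : (i < (i + j).+1)%N by lia.
pose F (l : 'I_(i + j).+1) := g`_l * h`_(i + j - l).
have Fi : F (Ordinal lt_i) = g`_i * h`_j by rewrite /F /= addKn.
have [|l|f0 vf] := @padic_val_sum_dominant p _ F (Ordinal lt_i) pp.
- by rewrite Fi mulf_neq0.
- rewrite -(inj_eq val_inj) /= => li; rewrite Fi /F mulf_eq0 negb_or.
  case/andP=> gl hl; rewrite -(@ltr_nat R) -(ltrD2r (- (s * (i + j)%:R))).
  have lk : (l <= i + j)%N by rewrite -ltnS.
  rewrite heightM // -{1}(addKn i j) heightM ?leq_addr ?addKn //.
  (* If the [l]-th term were not higher, both of its factors would touch, against [uniq_ij]. *)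
  rewrite ltNge; apply/negP => le_l; move/eqP: li; apply.
  have l1 := ti _ gl; have l2 := tj _ hl.
  by apply: (uniq_ij l (i + j - l)%N); [lia| |];
    [apply: touches_height_le tg gl _ | apply: touches_height_le th hl _]; lra.
split=> [|k fk]; first by rewrite coefM.
have -> : height p (g * h) s (i + j) = height p g s i + height p h s j.
  by rewrite /height coefM vf Fi padic_valM // !natrD; ring.
exact: height_mul_ge.
Qed.

(** * Edges and their succession *)

(* Possibly degenerate: l = r when s is not the slope of an edge. *)
Definition edge (R : realType) p f (s : R) (l r : nat) :=
  [/\ touches p f s l, touches p f s r &
      forall i, touches p f s i -> (l <= i <= r)%N].

(** The ends are extremal touching indices, so no other touching pair has sum [l + l'] or
    [r + r']. *)
Lemma edge_mul (R : realType) p (g h : {poly int}) (s : R) l r l' r' :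
  prime p -> edge p g s l r -> edge p h s l' r' ->
  touches p (g * h) s (l + l') /\ touches p (g * h) s (r + r').
Proof.
move=> pp [tl tr lr] [tl' tr' lr'].
by split; apply: touches_mul => // i j eq_ij /lr ? /lr' ?; lia.
Qed.

Lemma exists_edge (R : realType) p f (s : R) a :
  touches p f s a -> (forall i, touches p f s i -> (a <= i)%N) ->
  exists r, edge p f s a r.
Proof.
move=> ta min_a.
have exT : exists i, `[< touches p f s i >] by exists a; apply/asboolP.
have ubT i : `[< touches p f s i >] -> (i <= size f)%N.
  by move=> /asboolP[/coef_neq0_lt_size/ltnW].
case: (ex_maxnP exT ubT) => r /asboolP tr max_r.
exists r; split=> // i ti; rewrite min_a //=; apply: max_r; exact/asboolP.
Qed.

(** Raising the slope from [s] to [s'] lowers the height at [a] more than at any [i < a]. *)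
Lemma edge_height_lt (R : realType) p f (s s' : R) l a i :
  edge p f s l a -> s < s' -> (i < a)%N -> f`_i != 0 ->
  height p f s' a < height p f s' i.
Proof.
move=> [_ [fa ta] _] ss' ia fi; have := ta _ fi; rewrite /height.
have : (i%:R : R) < a%:R by rewrite ltr_nat.
nra.
Qed.

(* Rotating the supporting line about the right end of an edge: the polygon is
   touched at that end only until the slope of the next edge. *)
Lemma next_edge (R : realType) p f (s : R) l a : edge p f s l a ->
  [/\ a = (size f).-1 & forall s', s < s' -> edge p f s' a a] \/
  exists s1 r, [/\ s < s1, (a < r)%N, edge p f s1 a r &
                 forall s', s < s' -> s' < s1 -> edge p f s' a a].
Proof.
move=> E; have [_ ta max_a] := E; have [fa _] := ta.
(* For [s' > s] the points left of [a] are already higher, so only those to its right need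
   checking. *)
have pt s' : s < s' -> (forall i, (a < i)%N -> f`_i != 0 ->
    height p f s' a < height p f s' i) -> edge p f s' a a.
  move=> ss' gt_a.
  have ta' : touches p f s' a.
    split=> // j fj; have [ja|aj|->//] := ltngtP j a; apply: ltW.
    - exact: edge_height_lt E _ _ _.
    - exact: gt_a.
  split=> // i [fi ti]; have := ti _ fa.
  have [ia|ai|->//] := ltngtP i a.
    - by have := edge_height_lt E ss' ia fi; lra.
    - by have := gt_a _ ai fi; lra.
have a_lt : (a < size f)%N.
  exact: coef_neq0_lt_size.
have [aE|a_neq] := eqVneq a (size f).-1.
  left; split=> // s' ss'; apply: pt => // i ai fi; exfalso.
  by have := coef_neq0_lt_size fi; lia.
right.
have lt_n : ((size f).-1 < size f)%N by lia.
pose P (i : 'I_(size f)) := (a < i)%N && (f`_i != 0).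
(* [F i] is the slope of the chord from [a] to [i]; its minimum over the Newton points right of [a]
   is the next slope [s1]. *)
pose F (i : 'I_(size f)) : R :=
  ((padic_val p f`_i)%:R - (padic_val p f`_a)%:R) / (i%:R - a%:R).
have P0 : P (Ordinal lt_n).
  rewrite /P /=; apply/andP; split.
    by rewrite ltn_neqAle a_neq -ltnS prednK // (leq_ltn_trans _ a_lt).
  by rewrite -lead_coefE lead_coef_eq0 -size_poly_gt0 (leq_ltn_trans _ a_lt).
case: (arg_minP F P0) => i0 /andP[ai0 fi0] min_i0; set s1 := F i0.
have slopeE i : (a < i)%N -> ((i%:R : R) - a%:R) > 0.
  by move=> ai; rewrite subr_gt0 ltr_nat.
have hF (i : 'I_(size f)) s' : (a < i)%N -> height p f s' i - height p f s' a =
    (F i - s') * (i%:R - a%:R).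
  by move=> /slopeE ai; rewrite /F /height; field; lra.
have gtF i s' : (a < i)%N -> f`_i != 0 -> exists2 t, s1 <= t &
   height p f s' i - height p f s' a = (t - s') * (i%:R - a%:R).
  move=> ai fi.
  have lti : (i < size f)%N := coef_neq0_lt_size fi.
  by exists (F (Ordinal lti)); [apply: min_i0; rewrite /P /= ai | rewrite -hF].
have ss1 : s < s1.
  have := hF i0 s ai0; have := slopeE _ ai0.
  have: height p f s a < height p f s i0.
    by apply: touches_height_lt => // /max_a; lia.
  rewrite -/s1; nra.
have ta1 : touches p f s1 a.
  split=> // j fj; have [ja|aj|->//] := ltngtP j a.
    by apply/ltW/(edge_height_lt E).
  have [t t1] := gtF j s1 aj fj; have := slopeE _ aj; nra.
have [|r Er] := @exists_edge R p f s1 a ta1.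
  move=> i [fi ti]; rewrite leqNgt; apply/negP => ia.
  by have := edge_height_lt E ss1 ia fi; have := ti _ fa; lra.
exists s1, r; split=> //.
  have [_ _ max_r] := Er.
  have /max_r/andP[_] : touches p f s1 i0; last exact: leq_trans.
  apply: touches_height_le ta1 fi0 _.
  by have := hF i0 s1 ai0; rewrite -/s1 subrr mul0r; lra.
move=> s' ss' s's1; apply: pt => // i ai fi.
have [t t1] := gtF i s' ai fi; have := slopeE _ ai; nra.
Qed.

(** * Convex hull and lattice points on an edge *)

(** The half-plane above the line is convex and contains the Newton points, hence their hull. *)
Lemma height_line_le (R : realType) p (f : {poly int}) (s c : R)
    (P : convex_lmodType (R^o * R^o)%type) :
  (forall j, f`_j != 0 -> c <= height p f s j) ->
  convex_hull (newton_points R p f) P -> c + s * P.1 <= P.2.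
Proof.
move=> le_c hullP.
pose H : set (convex_lmodType (R^o * R^o)%type) := [set Q | c + s * Q.1 <= Q.2].
suff: H P by [].
apply: (smallest_sub (C := @convex_set R (R^o * R^o)%type) _ _ hullP).
- move=> x y t; rewrite !inE /H /= => xH yH.
  have t0 : 0 <= (t%:num : R) by [].
  have t1 : (t%:num : R) <= 1 by [].
  rewrite /GRing.scale /= /unstable.onem; move: t0 t1 xH yH.
  move: (t%:num : R) (x.1 : R) (x.2 : R) (y.1 : R) (y.2 : R) => u x1 x2 y1 y2.
  nra.
- by move=> Q [i [fi ->]]; rewrite /H /=; have := le_c _ fi; rewrite /height; lra.
Qed.

Lemma newton_polygon_edge (R : realType) p (f : {poly int}) (s : R) l r x :
  touches p f s l -> touches p f s r -> (l <= x <= r)%N ->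
  newton_polygon R p f (x%:R, height p f s l + s * x%:R).
Proof.
move=> tl tr /andP[lx xr]; have [fl ml] := tl; have [fr mr] := tr.
split=> [|y] /=; last first.
  by move=> /(height_line_le ml).
have pt i : f`_i != 0 -> convex_hull (newton_points R p f)
    (i%:R, (padic_val p f`_i)%:R).
  by move=> fi; apply: sub_gen_smallest; exists i.
have ptl i : touches p f s i -> convex_hull (newton_points R p f)
    (i%:R, height p f s l + s * i%:R).
  move=> ti; rewrite (touches_height_eq tl ti) /height subrK; exact: pt ti.1.
have [lr|lr] := leqP r l.
  by rewrite (_ : x = l); [exact: ptl | lia].
have lr' : (l%:R : R) < r%:R by rewrite ltr_nat.
have lx' : (l%:R : R) <= x%:R by rewrite ler_nat.
have xr' : (x%:R : R) <= r%:R by rewrite ler_nat.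
pose t : R := (r%:R - x%:R) / (r%:R - l%:R).
have t0 : 0 <= t by rewrite divr_ge0 // subr_ge0 // ltW.
have t1 : t <= 1 by rewrite ler_pdivrMr ?subr_gt0 //; lra.
have xE : t * l%:R + (1 - t) * r%:R = x%:R by rewrite /t; field; lra.
have yE : t * (height p f s l + s * l%:R) + (1 - t) * (height p f s l + s * r%:R)
    = height p f s l + s * x%:R by rewrite -xE; ring.
move=> A hA.
have := hA.1 _ _ (Itv01 t0 t1)
  (mem_set (ptl _ tl A hA)) (mem_set (ptl _ tr A hA)).
by rewrite inE; congr (A _); congr pair; [exact: xE | exact: yE].
Qed.

Definition lattice_abscissa (R : realType) p (f : {poly int}) (x : nat) : bool :=
  `[< exists y : int, newton_polygon R p f (x%:R, y%:~R) >].

Lemma lattice_abscissa_edge (R : realType) p (f : {poly int}) (s : R) l r x :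
  touches p f s l -> touches p f s r -> (l <= x <= r)%N ->
  lattice_abscissa R p f x = (s * (x%:R - l%:R) \is a Num.int).
Proof.
move=> tl tr lxr; have [hull_x min_x] := newton_polygon_edge tl tr lxr.
have -> : (s * (x%:R - l%:R) \is a Num.int) =
    (height p f s l + s * x%:R \is a Num.int).
  rewrite (_ : height p f s l + _ = (padic_val p f`_l)%:R + s * (x%:R - l%:R)).
    by rewrite rpredDl // natr_int.
  by rewrite /height; ring.
apply/asboolP/idP => [[y [hull_y min_y]]|/intrP[y yE]].
  apply/intrP; exists y; apply: le_anti.
  by rewrite min_x //= min_y.
by exists y; rewrite -yE; split.
Qed.

(** * Simultaneous walk along the polygons of two factors *)

(* a is the abscissa of an integral point on the edge of slope s, whose right
   end is above r. *)
Definition on_edge (R : realType) p (f : {poly int}) (s : R) (a r : nat) :=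
  exists l, [/\ edge p f s l r, (l <= a <= r)%N &
                s * (a%:R - l%:R) \is a Num.int].

Lemma on_edge_left (R : realType) p (f : {poly int}) (s : R) a r :
  edge p f s a r -> on_edge p f s a r.
Proof.
move=> E; exists a; split=> //; last by rewrite subrr mulr0 int_num0.
by have [ta _ /(_ _ ta)] := E; lia.
Qed.

Lemma edge_height_int (R : realType) p (f : {poly int}) (s : R) l r :
  touches p f s l -> touches p f s r -> s * (r%:R - l%:R) \is a Num.int.
Proof.
move=> tl tr; have := touches_height_eq tl tr; rewrite /height => eq_h.
rewrite (_ : s * _ = (padic_val p f`_r)%:R - (padic_val p f`_l)%:R); last lra.
by rewrite rpredB // natr_int.
Qed.

(** Measured from [l + l'], the abscissa is [(a - l) + (b - l') + k], and the first two parts have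
    integral product with [s]. *)
Lemma on_edge_mul_lattice (R : realType) p (g h : {poly int}) (s : R) a r b r' k :
  prime p -> on_edge p g s a r -> on_edge p h s b r' -> (a + b + k <= r + r')%N ->
  lattice_abscissa R p (g * h) (a + b + k) = (s * k%:R \is a Num.int).
Proof.
move=> pp [l [Eg la ia]] [l' [Eh lb ib]] le_r.
have [tl tr] := edge_mul pp Eg Eh.
rewrite (lattice_abscissa_edge tl tr); last by lia.
rewrite (_ : s * _ =
  s * (a%:R - l%:R) + s * (b%:R - l'%:R) + s * k%:R).
  by rewrite rpredDl // rpredD.
by rewrite !natrD; ring.
Qed.

(** The step [e] is the least positive integer with [s * e] integral. It depends on [s] alone, so
    segments of slope [s] have the same width for [g], [h] and [g * h]. *)
Lemma on_edge_step (R : realType) p (g h : {poly int}) (s : R) a r b r' :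
  prime p -> on_edge p g s a r -> on_edge p h s b r' -> (a < r)%N ->
  exists e, [/\ (0 < e)%N, on_edge p g s (a + e) r,
    lattice_abscissa R p (g * h) (a + b),
    lattice_abscissa R p (g * h) (a + b + e) &
    forall k, (0 < k < e)%N -> ~~ lattice_abscissa R p (g * h) (a + b + k)].
Proof.
move=> pp Og Oh ar; have [l [Eg la ia]] := Og; have [l' [Eh lb ib]] := Oh.
have [tl tr _] := Eg.
have ra_int : (0 < r - a)%N && (s * (r - a)%:R \is a Num.int).
  rewrite subn_gt0 ar natrB 1?ltnW //.
  rewrite (_ : s * _ = s * (r%:R - l%:R) - s * (a%:R - l%:R)); last by ring.
  by rewrite rpredB // (edge_height_int tl tr).
have exk : exists k, (0 < k)%N && (s * k%:R \is a Num.int) by exists (r - a)%N.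
case: (ex_minnP exk) => e /andP[e0 ie] min_e.
have er : (a + e <= r)%N by have := min_e _ ra_int; lia.
exists e; split=> //.
- exists l; split=> //; first lia.
  rewrite (_ : s * _ = s * (a%:R - l%:R) + s * e%:R).
    by rewrite rpredD.
  by rewrite natrD; ring.
- rewrite -(addn0 (a + b)%N) (on_edge_mul_lattice pp Og Oh) ?mulr0 ?int_num0 //; lia.
- by rewrite (on_edge_mul_lattice pp Og Oh) //; lia.
- move=> k /andP[k0 ke]; rewrite (on_edge_mul_lattice pp Og Oh); last lia.
  by apply: contraL ke => ik; rewrite -leqNgt min_e // k0.
Qed.

(** When both points are right ends, the smaller of the next slopes is taken; a polygon whose next
    slope is larger, or that has no further edge, is touched at its current point only. *)
Lemma on_edge_advance (R : realType) p (g h : {poly int}) (s : R) a r b r' :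
  on_edge p g s a r -> on_edge p h s b r' ->
  (a = (size g).-1 /\ b = (size h).-1) \/
  exists (s1 : R) r1 r1',
    [/\ on_edge p g s1 a r1, on_edge p h s1 b r1' & (a < r1)%N || (b < r1')%N].
Proof.
move=> Og Oh; have [l [Eg la _]] := Og; have [l' [Eh lb _]] := Oh.
have [ar|ra] := ltnP a r; first by right; exists s, r, r'; rewrite ar.
have [br|rb] := ltnP b r'; first by right; exists s, r, r'; rewrite br orbT.
have ea : r = a by lia.
have eb : r' = b by lia.
move: Eg Eh; rewrite ea eb => Eg Eh.
have [[ga keepg]|[s1 [r1 [ss1 ar1 E1 keepg]]]] := next_edge Eg;
  have [[hb keeph]|[s2 [r2 [ss2 br2 E2 keeph]]]] := next_edge Eh.
- by left.
- right; exists s2, a, r2; rewrite br2 orbT.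
  by split=> //; apply: on_edge_left => //; apply: keepg.
- right; exists s1, r1, b; rewrite ar1.
  by split=> //; apply: on_edge_left => //; apply: keeph.
- right; have [s12|s21|s12] := ltgtP s1 s2.
  + exists s1, r1, b; rewrite ar1.
    by split=> //; apply: on_edge_left => //; apply: keeph.
  + exists s2, a, r2; rewrite br2 orbT.
    by split=> //; apply: on_edge_left => //; apply: keepg.
  + exists s1, r1, r2; rewrite ar1.
    by split=> //; apply: on_edge_left => //; rewrite s12.
Qed.

(** For so steep a descent every [i > 0] has height at least [- s], which exceeds the height of
    0. *)
Lemma edge_at0 (R : realType) p (f : {poly int}) (s : R) : f`_0 != 0 ->
  s <= - (padic_val p f`_0)%:R - 1 -> edge p f s 0 0.
Proof.
move=> f0 le_s.
have gt0 i : (0 < i)%N -> height p f s 0 < height p f s i.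
  rewrite -(ler_nat R) /height => i1.
  have := ler0n R (padic_val p f`_0); have := ler0n R (padic_val p f`_i); nra.
have t0 : touches p f s 0.
  by split=> // -[|j] _ //; rewrite ltW // gt0.
split=> // -[|i] // [_ /(_ _ f0)]; have := gt0 i.+1 isT; lra.
Qed.

(** * Widths and subset sums *)

Definition consecutive_differences (xs : seq nat) : seq nat :=
  [seq (t.2 - t.1)%N | t <- zip xs (behead xs)].

(** Coefficients are indexed by [nat], not by ordinals as in [width_sums], so that prepending a
    width only shifts them. *)
Definition subset_sum (w : seq nat) (d : nat) :=
  exists c : nat -> bool, d = (\sum_(j < size w) c j * nth 0 w j)%N.

Lemma subset_sum_cons (b : bool) e w d :
  subset_sum w d -> subset_sum (e :: w) (b * e + d)%N.
Proof.
move=> [c ->]; exists (fun j => if j is j'.+1 then c j' else b).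
by rewrite /= big_ord_recl.
Qed.

Lemma consecutive_differences_step (P : pred nat) x e n : (0 < e)%N ->
  (x + e < n)%N -> P x -> P (x + e)%N ->
  (forall k, (0 < k < e)%N -> ~~ P (x + k)%N) ->
  consecutive_differences [seq y <- iota x (n - x) | P y] =
  e :: consecutive_differences [seq y <- iota (x + e) (n - (x + e)) | P y].
Proof.
case: e => // e _ lt_n Px Pxe noP.
have -> : (n - x = e.+1 + (n - (x + e.+1)))%N by lia.
have -> : (n - (x + e.+1) = (n - (x + e.+1)).-1.+1)%N by lia.
rewrite iotaD filter_cat /= Px Pxe.
rewrite (eq_in_filter (a2 := pred0)) ?filter_pred0 => [|y]; last first.
  rewrite mem_iota => /andP[xy ye]; apply/negbTE.
  by have := noP (y - x)%N; rewrite subnKC //; [apply; lia | lia].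
by rewrite /consecutive_differences /= addKn.
Qed.

(* A walk (a, b) along the polygons of g and h, merging their segments by
   increasing slope: a + b visits exactly the lattice abscissas of g * h, and the
   steps taken along g add up to its degree. *)
Lemma subset_sum_of_factor (R : realType) p (g h : {poly int}) (s : R) a r b r' :
  prime p -> g != 0 -> h != 0 -> on_edge p g s a r -> on_edge p h s b r' ->
  subset_sum
    (consecutive_differences
      [seq x <- iota (a + b) (size (g * h)%R - (a + b)) |
         lattice_abscissa R p (g * h) x])
    ((size g).-1 - a).
Proof.
move=> pp g0 h0.
have sz : size (g * h) = (size g + size h).-1 by rewrite size_mul.
have sg : (0 < size g)%N by rewrite size_poly_gt0.
have sh : (0 < size h)%N by rewrite size_poly_gt0.
have le_deg (f : {poly int}) (t : R) c q : on_edge p f t c q -> (c < size f)%N.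
  by move=> [l [[_ [/coef_neq0_lt_size ? _] _] ? _]]; lia.
have [N] := ubnP (size (g * h) - (a + b)).
elim: N s a r b r' => // N IH s a r b r' leN Og Oh.
have [[-> ->]|[s1 [r1 [r1' [Og1 Oh1]]]]] := on_edge_advance Og Oh.
  (* At the end of both polygons a single abscissa remains, so there are no widths and the sum is
     empty. *)
  rewrite subnn sz (_ : _ - _ = 1)%N; last by lia.
  by exists (fun=> false); rewrite big1.
(* A width crossed along [g] gets coefficient 1, one crossed along [h] gets 0. *)
case: ltnP => [ar _|_ /= br].
  have [e [e0 Oe lat0 late nolat]] := on_edge_step pp Og1 Oh1 ar.
  have lta := le_deg _ _ _ _ Oe; have ltb := le_deg _ _ _ _ Oh1.
  rewrite (consecutive_differences_step (e := e)) //; last by rewrite sz; lia.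
  have -> : ((size g).-1 - a = true * e + ((size g).-1 - (a + e)))%N by lia.
  rewrite (addnAC a b e); apply/subset_sum_cons/(IH _ _ _ _ _ _ Oe Oh1).
  by move: leN; rewrite sz; lia.
have [e [e0 Oe]] := on_edge_step pp Oh1 Og1 br.
rewrite [h * g]mulrC [(b + a)%N]addnC => lat0 late nolat.
have lta := le_deg _ _ _ _ Og1; have ltb := le_deg _ _ _ _ Oe.
rewrite (consecutive_differences_step (e := e)) //; last by rewrite sz; lia.
rewrite -[((size g).-1 - a)%N]/(false * e + ((size g).-1 - a))%N.
rewrite -addnA; apply/subset_sum_cons/(IH _ _ _ _ _ _ Og1 Oe).
by move: leN; rewrite sz; lia.
Qed.

Lemma width_sums_factor (R : realType) p (g h : {poly int}) :
  prime p -> (g * h)`_0 != 0 ->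
  (0 < (size g).-1 <= (size (g * h)%R).-1./2)%N ->
  width_sums R p (g * h) (size g).-1.
Proof.
move=> pp; rewrite coef0M mulf_eq0 negb_or => /andP[g0 h0] deg_g.
have nz (f : {poly int}) : f`_0 != 0 -> f != 0.
  by apply: contraNneq => ->; rewrite coef0.
(* Low enough for [edge_at0] to apply to both factors, so that both walks start at abscissa 0. *)
pose s : R := - (padic_val p g`_0)%:R - (padic_val p h`_0)%:R - 1.
have Eg : edge p g s 0 0.
  apply: edge_at0 => //; rewrite /s; have := ler0n R (padic_val p h`_0); lra.
have Eh : edge p h s 0 0.
  apply: edge_at0 => //; rewrite /s; have := ler0n R (padic_val p g`_0); lra.
have := subset_sum_of_factor pp (nz _ g0) (nz _ h0)
  (on_edge_left Eg) (on_edge_left Eh).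
rewrite addn0 !subn0 => -[c dE]; split=> //.
(* [segment_widths] is convertible to the list of differences in [dE]. *)
by exists (fun j => c j).
Qed.

Theorem theoremA (R : realType) (f : {poly int}) (n : nat)
    (n_ge1 : (1 <= n)%N) (deg_f : size f = n.+1) (f0_neq0 : f.[0] != 0)
    (k : nat) (k_ge2 : (2 <= k)%N) (p : 'I_k -> nat)
    (p_prime : forall i, prime (p i)) (p_inj : injective p)
    (disjoint_sums : \bigcap_(i in [set: 'I_k]) width_sums R (p i) f = set0) :
  irreducible_poly (map_poly (intr : int -> rat) f).
Proof.
apply/irreducible_rat_int; split; first by rewrite deg_f.
have no_factor (g h : {poly int}) : f = g * h ->
    ~ (0 < (size g).-1 <= n./2)%N.
  move=> fE deg_g.
  have : (\bigcap_(i in [set: 'I_k]) width_sums R (p i) f) (size g).-1.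
    move=> i _; rewrite fE; apply: width_sums_factor => //; rewrite -fE.
      by rewrite -horner_coef0.
    by rewrite deg_f.
  by rewrite disjoint_sums.
(* Divisibility is up to a constant here, so the factorisation over the integers involves the
   primitive part of [q]. *)
move=> q q1 q_dvd; have [r fE] := dvdpP_int q_dvd.
have f0 : f != 0 by rewrite -size_poly_gt0 deg_f.
have [q0 r0] : zprimitive q != 0 /\ r != 0.
  by apply/andP; rewrite -negb_or -mulf_eq0 -fE.
rewrite -dvdp_size_eqp // deg_f; apply/eqP.
have sz : n.+1 = (size (zprimitive q) + size r).-1 by rewrite -size_mul // -fE.
have sq : (0 < size (zprimitive q))%N by rewrite size_poly_gt0.
have sr : (0 < size r)%N by rewrite size_poly_gt0.
have := no_factor _ _ fE; have := no_factor r (zprimitive q).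
rewrite mulrC => /(_ fE).
(* The two degrees add up to [n], so one is at most [n./2] and hence 0; as [q] is not constant, it
   is that of the cofactor. *)
have arith (a b : nat) : n.+1 = (a + b).-1 -> (0 < a)%N -> (0 < b)%N ->
    a != 1%N -> ~ (0 < b.-1 <= n./2)%N -> ~ (0 < a.-1 <= n./2)%N -> a = n.+1.
  lia.
by move: sz sq sr q1; rewrite size_zprimitive; apply: arith.
Qed.
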